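(* Let $M$ be a von Neumann algebra, let $A$ be a unital $C^*$-algebra, let $C\subset A$ be a sub-$C^*$-algebra containing the unit of $A$, and let $\pi\colon C\to M$ be a unital $*$-homomorphism. Let $\phi\colon A\to M$ be a completely positive map which is a $C$-bimodule map with respect to $\pi$. Then there exists a projection $e\in\pi(C)'$ such that $\phi(A)\subset eMe$ and $\pi_e\colon C\to eMe$ admits a completely positive extension $A\to eMe$.
   Context: A bounded linear map $\phi\colon A\to M$ is called a $C$-bimodule map with respect to $\pi$ if $\phi(c_1ac_2)=\pi(c_1)\phi(a)\pi(c_2)$ for all $a\in A$ and all $c_1,c_2\in C$. Here $\pi(C)'\subset M$ denotes the commutant of the range of $\pi$ inside $M$, i.e. the set of elements of $M$ commuting with $\pi(c)$ for every $c\in C$. For a projection $e\in\pi(C)'$, the map $\pi_e\colon C\to eMe$ is defined by $\pi_e(c)=e\pi(c)e$; it is a unital $*$-homomorphism (the unit of $eMe$ being $e$). A completely positive extension of $\pi_e$ is a completely positive map $A\to eMe$ whose restriction to $C$ equals $\pi_e$. *)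

(* Defs.v *)
From HB Require Import structures.
From mathcomp Require Import all_boot all_order all_algebra.
From mathcomp Require Import complex ring lra.
From mathcomp Require Import all_classical all_reals all_analysis.

Set Implicit Arguments.
Unset Strict Implicit.
Unset Printing Implicit Defensive.

Import Order.TTheory GRing.Theory Num.Theory.
Import numFieldNormedType.Exports.

Local Open Scope classical_set_scope.
Local Open Scope ring_scope.

(* The multiplication is a field of the mixin because MathComp's hierarchy    *)
(* has no class joining rings with modules when 1 = 0 is allowed, nor rings   *)
(* with normed modules.                                                       *)
HB.mixin Record isStarAlgebra (K : numClosedFieldType) A
    of GRing.Lmodule K A := {
  amul : A -> A -> A ;
  aone : A ;
  star : A -> A ;
  amulA : associative amul ;
  amul1l : left_id aone amul ;
  amul1r : right_id aone amul ;
  amulDl : left_distributive amul +%R ;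
  amulDr : right_distributive amul +%R ;
  amulZl : forall (k : K) (a b : A), amul (k *: a) b = k *: amul a b ;
  amulZr : forall (k : K) (a b : A), amul a (k *: b) = k *: amul a b ;
  starK : involutive star ;
  starD : {morph star : a b / a + b} ;
  starZ : forall (k : K) (a : A), star (k *: a) = k^* *: star a ;
  starM : forall a b : A, star (amul a b) = amul (star b) (star a)
}.

#[short(type="starAlgType")]
HB.structure Definition StarAlgebra (K : numClosedFieldType) :=
  {A of GRing.Lmodule K A & isStarAlgebra K A}.

Arguments aone {K s}.

Notation "a ** b" := (amul a b) (at level 40, left associativity) : ring_scope.

HB.mixin Record isCStarAlgebra (R : realType) A
    of StarAlgebra R[i] A & CompleteNormedModule R[i] A := {
  norm_amul_le : forall a b : A, `|a ** b| <= `|a| * `|b| ;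
  norm_star_amul : forall a : A, `|star a ** a| = `|a| ^+ 2
}.

#[short(type="cstarAlgType")]
HB.structure Definition CStarAlgebra (R : realType) :=
  {A of StarAlgebra R[i] A & CompleteNormedModule R[i] A & isCStarAlgebra R A}.

(* The inner product is linear in its first argument. *)
HB.mixin Record isHilbert (R : realType) H of CompleteNormedModule R[i] H := {
  inner : {dot H for Num.conj} ;
  inner_norm : forall x : H, inner x x = `|x| ^+ 2
}.

#[short(type="hilbertType")]
HB.structure Definition Hilbert (R : realType) :=
  {H of CompleteNormedModule R[i] H & isHilbert R H}.

Section InnerProduct.
Variables (R : realType) (H : hilbertType R).
Implicit Types (x y z : H) (k : R[i]).

Lemma innerDl x y z : inner (x + y) z = inner x z + inner y z.
Proof. exact: linearDl. Qed.

Lemma innerDr x y z : inner x (y + z) = inner x y + inner x z.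
Proof. exact: linearDr. Qed.

Lemma innerZl k x y : inner (k *: x) y = k * inner x y.
Proof. exact: linearZl_LR. Qed.

Lemma innerZr k x y : inner x (k *: y) = k^* * inner x y.
Proof. exact: linearZr. Qed.

Lemma innerC x y : inner x y = (inner y x)^*.
Proof. by rewrite hermC /= expr0 mul1r. Qed.

End InnerProduct.

Section Riesz.
Variables (R : realType) (H : hilbertType R).
Implicit Types (x y z u v : H) (k : R[i]).

Local Notation rnorm x := (complex.Re `|x|).
Local Notation rinner x y := (complex.Re (inner x y)).

Lemma normCE x : `|x| = (rnorm x)%:C%C.
Proof. by rewrite RRe_real // normr_real. Qed.

Lemma rnorm_ge0 x : 0 <= rnorm x.
Proof. by rewrite -ler0c -normCE. Qed.

Lemma rinner_norm x : rinner x x = rnorm x ^+ 2.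
Proof. by rewrite inner_norm normCE -rmorphXn. Qed.

Lemma rinnerC x y : rinner x y = rinner y x.
Proof. by rewrite innerC; case: (inner y x). Qed.

Lemma rinnerDl x y z : rinner (x + y) z = rinner x z + rinner y z.
Proof. by rewrite innerDl raddfD. Qed.

Lemma rinnerDr x y z : rinner x (y + z) = rinner x y + rinner x z.
Proof. by rewrite innerDr raddfD. Qed.

Lemma ReZ (t : R) (k : R[i]) : complex.Re (t%:C%C * k) = t * complex.Re k.
Proof. by case: k => a b /=; rewrite mul0r subr0. Qed.

Lemma rinnerZl (t : R) x y : rinner (t%:C%C *: x) y = t * rinner x y.
Proof. by rewrite innerZl ReZ. Qed.

Lemma rinnerZr (t : R) x y : rinner x (t%:C%C *: y) = t * rinner x y.
Proof. by rewrite rinnerC rinnerZl rinnerC. Qed.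

Lemma rnormD2 x y : rnorm (x + y) ^+ 2 =
  rnorm x ^+ 2 + 2 * rinner x y + rnorm y ^+ 2.
Proof.
by rewrite -!rinner_norm !rinnerDl !rinnerDr (rinnerC y x); ring.
Qed.

Lemma rnormZ (t : R) x : rnorm (t%:C%C *: x) ^+ 2 = t ^+ 2 * rnorm x ^+ 2.
Proof. by rewrite -!rinner_norm rinnerZl rinnerZr mulrA -expr2. Qed.

Lemma rinner_le x y : rinner x y <= rnorm x * rnorm y.
Proof.
have : rnorm (x + y) <= rnorm x + rnorm y.
  by rewrite -lecR rmorphD /= -!normCE ler_normD.
have := rnorm_ge0 (x + y); have := rnorm_ge0 x; have := rnorm_ge0 y.
have := rnormD2 x y; nra.
Qed.

Lemma CauchySchwarz x y : `|inner x y| <= `|x| * `|y|.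
Proof.
have [->|n0] := eqVneq (inner x y) 0; first by rewrite normr0 mulr_ge0.
pose c := inner x y.
have cgt0 : 0 < `|c| by rewrite normr_gt0.
rewrite -(ler_pM2l cgt0) -expr2 mulrA -[`|c|]norm_conjC -normrZ.
have := rinner_le (c^* *: x) y; rewrite -lecR rmorphM /= -!normCE.
apply: le_trans.
rewrite innerZl mulrC -normCK RRe_real ?norm_conjC //.
Qed.

Lemma inner_inj u v : (forall x, inner x u = inner x v) -> u = v.
Proof.
move=> e; apply/eqP; rewrite -subr_eq0 -normr_eq0 -sqrf_eq0 -inner_norm.
by rewrite innerDr e -innerDr subrr linear0r.
Qed.

Variable f : {scalar H}.
Hypothesis f_bounded : exists M : R[i], forall x, `|f x| <= M * `|x|.

Let rf x := complex.Re (f x).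
Let J x := rnorm x ^+ 2 - 2 * rf x.

Let rfD x y : rf (x + y) = rf x + rf y.
Proof. by rewrite /rf !raddfD. Qed.

Let rfZ (t : R) x : rf (t%:C%C *: x) = t * rf x.
Proof. by rewrite /rf linearZ /= ReZ. Qed.

Let rf_le : exists2 m : R, 0 <= m & forall x, rf x <= m * rnorm x.
Proof.
have [M fM] := f_bounded; exists `|complex.Re M| => // x.
apply: (@le_trans _ _ (complex.Re M * rnorm x)); last first.
  by rewrite ler_wpM2r ?rnorm_ge0 // ler_norm.
have -> : complex.Re M * rnorm x = complex.Re (M * `|x|).
  by rewrite (normCE x); case: (M) => a b /=; rewrite mulr0 subr0.
have := fM x; rewrite lecE => /andP[_]; apply: le_trans.
have := normc_ge_Re (f x); rewrite lecE => /andP[_] /=.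
exact/le_trans/ler_norm.
Qed.

Let J_mid x y : rnorm (x - y) ^+ 2 =
  2 * J x + 2 * J y - 4 * J ((2^-1 : R)%:C%C *: (x + y)).
Proof.
rewrite /J rnormZ rfZ rfD.
have -> : x - y = x + (-1)%:C%C *: y by rewrite rmorphN scaleN1r.
rewrite !rnormD2 rnormZ rinnerZr; by field.
Qed.

(* The vector representing f minimises J; J_mid makes minimising sequences  *)
(* Cauchy.                                                                   *)
Lemma Riesz_representation : exists u, forall x, f x = inner x u.
Proof.
have [m m0 rfm] := rf_le.
pose E := range J.
have lbE : lbound E (- m ^+ 2).
  move=> _ [x _ <-]; rewrite /J; have := rfm x.
  by have := sqr_ge0 (rnorm x - m); rewrite sqrrB; lra.
have hE : has_inf E by split; [exists (J 0), 0 | exists (- m ^+ 2)].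
pose j := inf E.
have jle x : j <= J x by apply: ge_inf; [exists (- m ^+ 2) | exists x].
have min_seq n : exists x, J x < j + n.+1%:R^-1.
  have e0 : 0 < n.+1%:R^-1 :> R by rewrite invr_gt0 ltr0n.
  by have [_ [x _ <-]] := inf_adherent e0 hE; exists x.
have [s sP] := choice min_seq.
have sdist n p : rnorm (s n - s p) ^+ 2 <= 2 * n.+1%:R^-1 + 2 * p.+1%:R^-1.
  rewrite J_mid; have := sP n; have := sP p.
  have := jle ((2^-1 : R)%:C%C *: (s n + s p)).
  move: (J _) (J _) (J _) (n.+1%:R^-1) (p.+1%:R^-1) => a b c d e; lra.
have small (e : R) : 0 < e -> exists N, forall n, (N <= n)%N -> n.+1%:R^-1 < e.
  move=> e0; have [N _ NP] := near_infty_natSinv_lt (PosNum e0).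
  by exists N => n Nn; apply: NP.
have cs : cauchy (s @ \oo).
  apply: cauchy_exP => e e0.
  have [r er] : exists r : R, e = r%:C%C.
    by exists (complex.Re e); rewrite RRe_real // gtr0_real.
  have r0 : 0 < r by move: e0; rewrite er ltcR.
  have [|N NP] := small (r ^+ 2 / 4); first by rewrite divr_gt0 ?exprn_gt0.
  exists (s N); exists N => // n /= Nn.
  rewrite -ball_normE /ball_ /= er normCE ltcR.
  rewrite -(@ltr_pXn2r _ 2) ?nnegrE ?rnorm_ge0 ?(ltW r0) //.
  apply: le_lt_trans (sdist N n) _; have := NP n Nn; have := NP N (leqnn N).
  by move: (N.+1%:R^-1) (n.+1%:R^-1) => a b; lra.
have /cauchy_cvgP/cvg_ex[u /cvgrPdist_lt su] := cs.
have {}su (e : R) : 0 < e -> exists N, forall n, (N <= n)%N -> rnorm (u - s n) < e.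
  move=> e0; have [|N _ NP] := su e%:C%C; first by rewrite ltcR.
  by exists N => n /NP /=; rewrite normCE ltcR.
have Jdiff x d : J (x + d) = J x + 2 * rinner x d + rnorm d ^+ 2 - 2 * rf d.
  by rewrite /J rnormD2 rfD; ring.
have Ju : J u <= j.
  rewrite leNgt; apply/negP => lt.
  pose e := J u - j; have e0 : 0 < e by rewrite subr_gt0.
  pose K := 2 * rnorm u + 2 * m + 2.
  have K0 : 0 < K by rewrite /K; have := rnorm_ge0 u; lra.
  have [|N1 N1P] := small (e / 2); first by lra.
  have [|N2 N2P] := su (e / 2 / K); first by rewrite !divr_gt0.
  pose n := maxn N1 N2; pose d := s n - u.
  have ud : u - s n = - d by rewrite opprB.
  have dE : s n = u + d by rewrite addrC subrK.
  have := N1P n (leq_maxl _ _); have := N2P n (leq_maxr _ _).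
  rewrite ltr_pdivlMr // ud normrN.
  have := sP n; rewrite {1}dE Jdiff; have := rfm d.
  have := rinner_le u (- d); rewrite linearNr raddfN /= normrN.
  have := rnorm_ge0 d; have := sqr_ge0 (rnorm d).
  rewrite /K /e; move: (n.+1%:R^-1) => c.
  rewrite !mulrDr; move: (rf d) (rinner u d) (J u) => r1 r2 r3.
  by rewrite ![rnorm d * (2 * _)]mulrCA ![rnorm d * _]mulrC; lra.
have var v : rf v <= rinner v u.
  rewrite leNgt; apply/negP => lt.
  pose g := rf v - rinner v u; have g0 : 0 < g by rewrite subr_gt0.
  pose q := rnorm v ^+ 2 + 1; have q0 : 0 < q by rewrite ltr_wpDl ?sqr_ge0.
  pose t := g / q; have tq : t * q = g by rewrite divfK ?gt_eqF.
  have t0 : 0 < t by rewrite divr_gt0.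
  have := jle (u + t%:C%C *: v); rewrite Jdiff rnormZ rfZ rinnerZr rinnerC.
  rewrite /q /g in tq g0 q0; have := sqr_ge0 (rnorm v); nra.
have rE v : rf v = rinner v u.
  apply/eqP; rewrite eq_le var /=.
  have := var (- v); rewrite /rf !raddfN /= linearNl raddfN; lra.
exists u => x; apply/eqP; rewrite eq_complex; apply/andP; split; first exact/eqP/rE.
have /eqP := rE ('i *: x); rewrite /rf linearZ /= innerZl -complexiE.
by rewrite ['i%C * f x]mulrC ['i%C * inner x u]mulrC !ReiNIm eqr_opp.
Qed.

End Riesz.

Section BoundedOperators.
Variables (R : realType) (H : hilbertType R).

Definition bounded_linear (f : H -> H) : Prop :=
  linear f /\ exists M : R[i], forall x, `|f x| <= M * `|x|.

Definition bounded_linear_pred : {pred H -> H} :=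
  fun f => `[< bounded_linear f >].

(* B(H) *)
Record bop := Bop {
  bop_fun :> H -> H ;
  bop_bounded : bop_fun \in bounded_linear_pred }.

HB.instance Definition _ := [isSub for bop_fun].
HB.instance Definition _ := [Choice of bop by <:].

Lemma bounded_linear_submod_closed : submod_closed bounded_linear_pred.
Proof.
split=> [|k f g /asboolP[lf [M fM]] /asboolP[lg [N gN]]]; apply/asboolP.
  split=> [a x y|]; first by rewrite scaler0 addr0.
  by exists 0 => x; rewrite normr0 mul0r.
split=> [a x y|].
  rewrite !fctE lf lg !scalerDr !scalerA [k * a]mulrC.
  by rewrite -!addrA; congr (_ + _); rewrite addrCA.
exists (`|k| * M + N) => x.
rewrite mulrDl; apply: le_trans (ler_normD _ _) _; apply: lerD => //.
by rewrite normrZ -mulrA ler_wpM2l.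
Qed.

HB.instance Definition _ :=
  GRing.isSubmodClosed.Build R[i] (H -> H) bounded_linear_pred
    bounded_linear_submod_closed.
HB.instance Definition _ := [SubChoice_isSubLmodule of bop by <:].

Lemma bopP (T : bop) : bounded_linear T.
Proof. exact/asboolP/bop_bounded. Qed.

Lemma bop_ext (S T : bop) : S =1 T -> S = T.
Proof. by move=> e; apply/val_inj/funext. Qed.

Definition bop_mk (f : H -> H) (fP : bounded_linear f) : bop :=
  Bop (introT (asboolP _) fP).

Lemma bopD (S T : bop) x : (S + T) x = S x + T x. Proof. by []. Qed.

Lemma bopZ k (T : bop) x : (k *: T) x = k *: T x. Proof. by []. Qed.

Lemma bop_scalable (T : bop) k x : T (k *: x) = k *: T x.
Proof.
have [lT _] := bopP T.
have T0 : T 0 = 0.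
  have := lT (-1) 0 0; rewrite scaler0 addr0 scaleN1r => {1}->.
  by rewrite addNr.
by rewrite -[k *: x]addr0 lT T0 addr0.
Qed.

Lemma bop_additive (T : bop) x y : T (x + y) = T x + T y.
Proof. by have [lT _] := bopP T; have := lT 1 x y; rewrite !scale1r. Qed.

Lemma bop_bound (T : bop) :
  exists2 M : R[i], 0 <= M & forall x, `|T x| <= M * `|x|.
Proof.
have [_ [M TM]] := bopP T.
have [x0|x0] := pselect (exists x : H, x != 0); last first.
  exists 0 => // x; have [->|xn0] := eqVneq x 0; last by case: x0; exists x.
  by rewrite -(scale0r (0 : H)) bop_scalable scale0r normr0 mul0r.
have [x xn0] := x0; exists M => //.
have xgt0 : 0 < `|x| by rewrite normr_gt0.
by rewrite -(pmulr_lge0 _ xgt0); apply: le_trans (TM x).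
Qed.

Lemma bop_id_subproof : bounded_linear idfun.
Proof. by split=> //; exists 1 => x; rewrite mul1r. Qed.
Definition bop_id := bop_mk bop_id_subproof.

Lemma bop_comp_subproof (S T : bop) : bounded_linear (S \o T).
Proof.
split=> [k x y|] /=; first by rewrite !bop_additive !bop_scalable.
have [M M0 SM] := bop_bound S; have [N N0 TN] := bop_bound T.
exists (M * N) => x; apply: le_trans (SM _) _.
by rewrite -mulrA ler_wpM2l.
Qed.
Definition bop_comp (S T : bop) := bop_mk (bop_comp_subproof S T).

Lemma adjoint_exists (T : bop) :
  exists T' : bop, forall x y, inner (T x) y = inner x (T' y).
Proof.
have [M M0 TM] := bop_bound T.
have ex y : exists z, forall x, inner (T x) y = inner x z.
  have lf : scalar (fun x => inner (T x) y).
    by move=> k a b; rewrite bop_additive bop_scalable innerDl innerZl.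
  pose f : {scalar H} := HB.pack (fun x => inner (T x) y)
    (GRing.isLinear.Build R[i] H R[i] *%R _ lf).
  apply: (@Riesz_representation R H f); exists (M * `|y|) => x /=.
  apply: le_trans (CauchySchwarz _ _) _.
  by rewrite mulrAC ler_wpM2r.
have [g gP] := choice ex.
suff bg : bounded_linear g by exists (bop_mk bg) => x y; rewrite gP.
split=> [k x y|].
  apply: inner_inj => z.
  by rewrite -gP !innerDr !innerZr !gP.
exists M => y; have [->|gy] := eqVneq (g y) 0; first by rewrite normr0 mulr_ge0.
have gy0 : 0 < `|g y| by rewrite normr_gt0.
rewrite -(ler_pM2l gy0) -expr2 -inner_norm -gP.
rewrite -[leLHS]ger0_norm; last by rewrite gP inner_norm exprn_ge0.
apply: le_trans (CauchySchwarz _ _) _.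
by rewrite mulrA [_ * M]mulrC ler_wpM2r.
Qed.

Definition bop_adj (T : bop) : bop := projT1 (cid (adjoint_exists T)).

Lemma bop_adjP (T : bop) x y : inner (T x) y = inner x (bop_adj T y).
Proof. by rewrite /bop_adj; case: cid. Qed.

Lemma bop_adjP' (T : bop) x y : inner (bop_adj T x) y = inner x (T y).
Proof. by rewrite innerC -bop_adjP -innerC. Qed.

Lemma bop_compA : associative bop_comp.
Proof. by move=> ? ? ?; apply: bop_ext. Qed.
Lemma bop_comp1l : left_id bop_id bop_comp.
Proof. by move=> ?; apply: bop_ext. Qed.
Lemma bop_comp1r : right_id bop_id bop_comp.
Proof. by move=> ?; apply: bop_ext. Qed.
Lemma bop_compDl : left_distributive bop_comp +%R.
Proof. by move=> ? ? ?; apply: bop_ext. Qed.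
Lemma bop_compDr : right_distributive bop_comp +%R.
Proof. by move=> S T U; apply: bop_ext => x /=; rewrite bop_additive. Qed.
Lemma bop_compZl k S T : bop_comp (k *: S) T = k *: bop_comp S T.
Proof. exact: bop_ext. Qed.
Lemma bop_compZr k S T : bop_comp S (k *: T) = k *: bop_comp S T.
Proof. by apply: bop_ext => x /=; rewrite bop_scalable. Qed.
Lemma bop_adjK : involutive bop_adj.
Proof.
move=> T; apply: bop_ext => y; apply: inner_inj => x.
by rewrite -bop_adjP bop_adjP'.
Qed.
Lemma bop_adjD : {morph bop_adj : S T / S + T}.
Proof.
move=> S T; apply: bop_ext => y; apply: inner_inj => x.
by rewrite -bop_adjP !bopD innerDr innerDl !bop_adjP.
Qed.
Lemma bop_adjZ k T : bop_adj (k *: T) = k^* *: bop_adj T.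
Proof.
apply: bop_ext => y; apply: inner_inj => x.
by rewrite -bop_adjP !bopZ innerZr innerZl conjCK bop_adjP.
Qed.
Lemma bop_adjM S T : bop_adj (bop_comp S T) = bop_comp (bop_adj T) (bop_adj S).
Proof.
by apply: bop_ext => y; apply: inner_inj => x; rewrite -bop_adjP /= !bop_adjP.
Qed.

HB.instance Definition _ := isStarAlgebra.Build R[i] bop
  bop_compA bop_comp1l bop_comp1r bop_compDl bop_compDr bop_compZl bop_compZr
  bop_adjK bop_adjD bop_adjZ bop_adjM.

End BoundedOperators.

Section Subalgebras.
Variables (K : numClosedFieldType) (A : starAlgType K).
Implicit Types (S : set A) (e : A).

Definition star_subalgebra S : Prop :=
  [/\ S 0,
      forall (k : K) a b, S a -> S b -> S (k *: a + b),
      forall a b, S a -> S b -> S (a ** b)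
    & forall a, S a -> S (star a)].

Definition commutant S : set A := [set a | forall s, S s -> s ** a = a ** s].

Definition projection e : Prop := e ** e = e /\ star e = e.

Definition corner e S : set A := [set e ** s ** e | s in S].

(* X = Y^* Y in M_n(S), with (Y^* )_ik = (Y_ki)^*. *)
Definition mx_positive S n (X : 'M[A]_n) : Prop :=
  exists2 Y : 'M[A]_n, (forall i j, S (Y i j)) &
    forall i j, X i j = \sum_(k < n) star (Y k i) ** Y k j.

End Subalgebras.

Definition cstar_subalgebra (R : realType) (A : cstarAlgType R) (C : set A) :
    Prop :=
  star_subalgebra C /\ closed C.

Definition von_neumann_algebra (R : realType) (H : hilbertType R)
    (M : set (bop H)) : Prop :=
  star_subalgebra M /\ commutant (commutant M) = M.

Section Maps.
Variables (K : numClosedFieldType) (A B : starAlgType K).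

(* Complete positivity of phi : A -> S. *)
Definition completely_positive (S : set B) (phi : {linear A -> B}) : Prop :=
  (forall a, S (phi a)) /\
  forall n (X : 'M[A]_n), mx_positive setT X -> mx_positive S (map_mx phi X).

(* A map C -> S is a function on A whose values outside C are irrelevant. *)
Definition unital_star_hom (C : set A) (S : set B) (pi : A -> B) : Prop :=
  [/\ forall c, C c -> S (pi c),
      forall (k : K) c1 c2, C c1 -> C c2 -> pi (k *: c1 + c2) = k *: pi c1 + pi c2,
      forall c1 c2, C c1 -> C c2 -> pi (c1 ** c2) = pi c1 ** pi c2,
      forall c, C c -> pi (star c) = star (pi c)
    & pi aone = aone].

End Maps.

(* |phi a| <= M |a| for the operator norm, which bop does not carry. *)
Definition bounded_map (R : realType) (A : cstarAlgType R) (H : hilbertType R)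
    (phi : A -> bop H) : Prop :=
  exists M : R[i], forall a x, `|phi a x| <= M * `|a| * `|x|.

Definition bimodule_map (R : realType) (A : cstarAlgType R) (H : hilbertType R)
    (C : set A) (pi : A -> bop H) (phi : {linear A -> bop H}) : Prop :=
  bounded_map phi /\
  forall a c1 c2, C c1 -> C c2 -> phi (c1 ** a ** c2) = pi c1 ** phi a ** pi c2.

(* Main.v *)
From HB Require Import structures.
Require Import Defs.
From mathcomp Require Import all_boot all_order all_algebra.
From mathcomp Require Import complex ring lra.
From mathcomp Require Import all_classical all_reals all_analysis.

Set Implicit Arguments.
Unset Strict Implicit.
Unset Printing Implicit Defensive.

Import Order.TTheory GRing.Theory Num.Theory.
Import numFieldNormedType.Exports.

Local Open Scope classical_set_scope.
Local Open Scope ring_scope.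

(** Put h = phi 1 >= 0, let s be its square root and e the projection onto the
    closure of the range of s.  Bimodularity gives phi c = pi c h = h pi c for c
    in C, so that h, hence s, hence e, commutes with pi(C).  The extension is the
    compression psi a = s^-1 phi a s^-1: formally psi c = s^-1 pi c h s^-1 =
    e pi c e, and the work lies in giving a meaning to s^-1.

    For every a there is a unique operator T = e T e with s T s = phi a.  It
    exists because the form (phi a x, y) is bounded by a multiple of |s x| |s y|:
    2-positivity gives |(phi a x, y)|^2 <= (h y, y) (phi (a^* a) x, x)
    ([cp_cauchy_schwarz]), and iterating this inequality on squares bounds
    phi (a^* a) by a multiple of h ([cp_square_le]); Douglas' factorisation,
    applied on either side, then produces T ([sandwich_factor]).  Uniqueness
    ([sandwich_inj]) makes psi linear, turns the identity s (e pi c e) s = phi c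
    into psi c = e pi c e, and, with the bicommutant property M'' = M, puts all
    the operators constructed here into M.

    For complete positivity, write phi(X) = Z^* Z with Z over M.  Factoring every
    entry of Z as W_kj s yields psi(X) = W^* W, but W only has entries in M e.
    It is traded for a matrix over e M e with the same Gram matrix by the
    Gram-Schmidt process, in which the normalisation of a column is the polar
    decomposition in M ([gram_schmidt]).

    The square roots are limits of the iteration y <- (k + y^2) / 2, started at 0
    with k = 1 - h / C, which tends to 1 - (h / C)^(1/2) ([contraction_root]).
    With y this limit, the powers y^(2n) tend strongly to the projection onto the
    kernel of 1 - y ([support_one_sub]), and the partial sums u_n of the geometric
    series satisfy (1 - y) u_n = 1 - y^(2n).  Thus s u_n -> e strongly (after
    rescaling u_n), which is the form in which s^-1 is used ([support_of]).

    Since a complex inner product is determined by its real part, norms and inner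
    products are handled through the real numbers Re |x| and Re (x, y). *)

Local Notation rnorm x := (complex.Re `|x|).
Local Notation rinner x y := (complex.Re (inner x y)).

(** * Real norm and real inner product *)

Section RealNorm.
Variables (R : realType) (H : hilbertType R).
Implicit Types (x y z : H) (S T : bop H).

Lemma rnormD x y : rnorm (x + y) <= rnorm x + rnorm y.
Proof. by rewrite -lecR rmorphD /= -!normCE ler_normD. Qed.

Lemma rnormN x : rnorm (- x) = rnorm x.
Proof. by rewrite normrN. Qed.

Lemma rnorm_distC x y : rnorm (x - y) = rnorm (y - x).
Proof. by rewrite distrC. Qed.

Lemma rnorm0 : rnorm (0 : H) = 0.
Proof. by rewrite normr0. Qed.

Lemma rnorm0_eq0 x : rnorm x = 0 -> x = 0.
Proof. by move=> x0; apply/eqP; rewrite -normr_eq0 normCE x0. Qed.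

Lemma rnorm2_eq0 x : rnorm x ^+ 2 <= 0 -> x = 0.
Proof.
by move=> x0; apply/rnorm0_eq0/eqP; rewrite -sqrf_eq0 eq_le x0 sqr_ge0.
Qed.

Lemma rnorm_scale (t : R) x : 0 <= t -> rnorm (t%:C%C *: x) = t * rnorm x.
Proof.
move=> t0; apply/eqP; rewrite -(@eqrXn2 _ 2) ?mulr_ge0 ?rnorm_ge0 //.
by rewrite rnormZ exprMn.
Qed.

Lemma rinnerNl x y : rinner (- x) y = - rinner x y.
Proof. by rewrite linearNl raddfN. Qed.

Lemma rinnerNr x y : rinner x (- y) = - rinner x y.
Proof. by rewrite linearNr raddfN. Qed.

Lemma rinner_abs_le x y : `|rinner x y| <= rnorm x * rnorm y.
Proof.
rewrite ler_norml rinner_le andbT lerNl -rinnerNl.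
by apply: le_trans (rinner_le _ _) _; rewrite rnormN.
Qed.

Lemma rinner_inj x y : (forall z, rinner z x = rinner z y) -> x = y.
Proof.
move=> e; apply/eqP; rewrite -subr_eq0; apply/eqP/rnorm2_eq0.
by rewrite -rinner_norm rinnerDr rinnerNr e subrr.
Qed.

(** * Pointwise calculus of bounded operators *)

Lemma bopM S T x : (S ** T) x = S (T x). Proof. by []. Qed.
Lemma bop0 x : (0 : bop H) x = 0. Proof. by []. Qed.
Lemma bopN T x : (- T) x = - T x. Proof. by []. Qed.

Lemma bop_sum (I : Type) (r : seq I) (P : pred I) (F : I -> bop H) x :
  (\sum_(i <- r | P i) F i) x = \sum_(i <- r | P i) F i x.
Proof. by elim/big_rec2: _ => // i y T _ <-. Qed.

Lemma bop_at0 T : T 0 = 0.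
Proof. by rewrite -[X in T X](scale0r (0 : H)) bop_scalable scale0r. Qed.

Lemma bop_opp T x : T (- x) = - T x.
Proof. by rewrite -scaleN1r bop_scalable scaleN1r. Qed.

Lemma rinner_adj T x y : rinner (T x) y = rinner x (star T y).
Proof. by rewrite bop_adjP. Qed.

Lemma rinner_adjr T x y : rinner x (T y) = rinner (star T x) y.
Proof. by rewrite rinner_adj starK. Qed.

Lemma rinner_sa T x y : star T = T -> rinner (T x) y = rinner x (T y).
Proof. by move=> sa; rewrite rinner_adj sa. Qed.

Lemma star_of_rinner S T :
  (forall x y, rinner (T x) y = rinner x (S y)) -> star T = S.
Proof.
move=> e; apply: bop_ext => y; apply: rinner_inj => x.
by rewrite -rinner_adj e.
Qed.

Lemma bop_rbound T : exists2 K : R, 0 < K & forall x, rnorm (T x) <= K * rnorm x.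
Proof.
have [K K0 TK] := bop_bound T; exists (complex.Re K + 1).
  by rewrite ltr_wpDl // -ler0c RRe_real // ger0_real.
move=> x; rewrite mulrDl mul1r.
have : rnorm (T x) <= complex.Re K * rnorm x.
  by rewrite -lecR rmorphM /= -!normCE RRe_real ?ger0_real.
by have := rnorm_ge0 x; lra.
Qed.

Lemma bounded_linearP (f : H -> H) (K : R) : linear f ->
  (forall x, rnorm (f x) <= K * rnorm x) -> bounded_linear f.
Proof.
move=> lf fK; split=> //; exists K%:C%C => x.
by rewrite [`|f x|]normCE [`|x|]normCE -rmorphM lecR.
Qed.

(** * Limits in a Hilbert space *)

Lemma cvg_rnormP (v : nat -> H) (l : H) :
  v @ \oo --> l <->
  forall e : R, 0 < e -> exists N, forall n, (N <= n)%N -> rnorm (v n - l) < e.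
Proof.
split=> [/cvgrPdist_lt vl e e0|vl].
  have [|N _ NP] := vl e%:C%C; first by rewrite ltcR.
  by exists N => n /NP /=; rewrite distrC normCE ltcR.
apply/cvgrPdist_lt => e e0.
have eR : e = (complex.Re e)%:C%C by rewrite RRe_real // gtr0_real.
have [|N NP] := vl (complex.Re e); first by rewrite -ltcR -eR.
by exists N => // n /NP /=; rewrite eR distrC normCE ltcR.
Qed.

Lemma cvg_lim_eq (v : nat -> H) (l l' : H) : v @ \oo --> l -> v @ \oo --> l' -> l = l'.
Proof. exact/cvg_unique/norm_hausdorff. Qed.

Lemma cvg_rnorm_le (v : nat -> H) (l : H) (w : nat -> R) :
  (forall n, rnorm (v n - l) <= w n) -> w @ \oo --> (0 : R) -> v @ \oo --> l.
Proof.
move=> vw /cvgrPdist_lt w0; apply/cvg_rnormP => e /w0[N _ NP].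
exists N => n /NP /=; rewrite sub0r normrN.
exact/le_lt_trans/(le_trans (vw n))/ler_norm.
Qed.

Lemma cvg_rnorm_dist (v : nat -> H) (l : H) :
  v @ \oo --> l -> (fun n => rnorm (v n - l)) @ \oo --> (0 : R).
Proof.
move=> /cvg_rnormP vl; apply/cvgrPdist_lt => e /vl[N NP].
by exists N => // n /NP /=; rewrite sub0r normrN ger0_norm // rnorm_ge0.
Qed.

Lemma cvg_bop T (v : nat -> H) (l : H) : v @ \oo --> l -> (fun n => T (v n)) @ \oo --> T l.
Proof.
move=> vl; have [K K0 TK] := bop_rbound T.
apply: (@cvg_rnorm_le _ _ (fun n => K * rnorm (v n - l))).
  by move=> n; rewrite -bop_opp -bop_additive.
by rewrite -(mulr0 K); apply: cvgMl_tmp; apply: cvg_rnorm_dist.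
Qed.

Lemma cvg_rinner (v : nat -> H) (l : H) y :
  v @ \oo --> l -> (fun n => rinner (v n) y) @ \oo --> rinner l y.
Proof.
move=> /cvg_rnorm_dist vl; apply/cvgrPdist_lt => e e0.
have yp : 0 < rnorm y + 1 by have := rnorm_ge0 y; lra.
have /cvgrPdist_lt/(_ (e / (rnorm y + 1))) := vl.
case; first by rewrite divr_gt0.
move=> N _ NP; exists N => // n /NP /=.
rewrite sub0r normrN ger0_norm ?rnorm_ge0 // ltr_pdivlMr //.
rewrite distrC -rinnerNl -rinnerDl; apply: le_lt_trans.
apply: le_trans (rinner_abs_le _ _) _.
by rewrite ler_wpM2l ?rnorm_ge0 //; lra.
Qed.

Lemma rinner_cvg_le (v : nat -> H) (l : H) y (c : R) :
  v @ \oo --> l -> (forall n, rinner (v n) y <= c) -> rinner l y <= c.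
Proof.
move=> /cvg_rinner-/(_ y) vl vc; apply: (cvgr_to_le vl).
by exists 0%N => // n _; apply: vc.
Qed.

Lemma rnorm_cvg_le (v : nat -> H) (l : H) (c : R) :
  v @ \oo --> l -> (forall n, rnorm (v n) <= c) -> rnorm l <= c.
Proof.
move=> vl vc; have [l0|l0] := leP (rnorm l) 0.
  by apply: le_trans l0 (le_trans (rnorm_ge0 _) (vc 0%N)).
rewrite -(ler_pM2r l0) -expr2 -rinner_norm; apply: (rinner_cvg_le vl) => n.
by apply: le_trans (rinner_le _ _) _; rewrite ler_wpM2r ?rnorm_ge0.
Qed.

Lemma cauchy_cvg_rnorm (v : nat -> H) :
  (forall e : R, 0 < e -> exists N, forall m n, (N <= m)%N -> (N <= n)%N ->
     rnorm (v m - v n) < e) ->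
  exists l : H, v @ \oo --> l.
Proof.
move=> cv; have : cauchy (v @ \oo).
  apply: cauchy_exP => e e0.
  have eR : e = (complex.Re e)%:C%C by rewrite RRe_real // gtr0_real.
  have [|N NP] := cv (complex.Re e); first by rewrite -ltcR -eR.
  exists (v N); exists N => // n /= Nn.
  by rewrite -ball_normE /ball_ /= eR normCE ltcR; apply: NP.
by move=> /cauchy_cvgP/cvg_ex[l vl]; exists l.
Qed.

Lemma strong_limit (T : nat -> bop H) (K : R) :
  (forall n x, rnorm (T n x) <= K * rnorm x) ->
  (forall x, exists l : H, (fun n => T n x) @ \oo --> l) ->
  exists S : bop H, forall x, (fun n => T n x) @ \oo --> S x.
Proof.
move=> TK /choice[S TS].
suff bS : bounded_linear S by exists (bop_mk bS).
apply: (@bounded_linearP _ K) => [a x y|x].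
  apply: cvg_lim_eq (TS _) _.
  have -> : (fun n => T n (a *: x + y)) = (fun n => a *: T n x + T n y).
    by apply/funext => n; rewrite bop_additive bop_scalable.
  apply: cvgD => //; exact: cvgZl_tmp.
exact: rnorm_cvg_le (TS x) _.
Qed.

Lemma strong_limit_sa (T : nat -> bop H) S :
  (forall n, star (T n) = T n) -> (forall x, (fun n => T n x) @ \oo --> S x) ->
  star S = S.
Proof.
move=> sa TS; apply: star_of_rinner => x y.
have e : (fun n => rinner (T n x) y) = (fun n => rinner (T n y) x).
  by apply/funext => n; rewrite rinner_sa // rinnerC.
have l1 := cvg_rinner (y := y) (TS x); rewrite e in l1.
have l2 := cvg_rinner (y := x) (TS y).
by rewrite [RHS]rinnerC; apply: cvg_unique l1 l2; apply: norm_hausdorff.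
Qed.

Lemma strong_limit_comm (T : nat -> bop H) S t :
  (forall n, t ** T n = T n ** t) -> (forall x, (fun n => T n x) @ \oo --> S x) ->
  t ** S = S ** t.
Proof.
move=> tT TS; apply: bop_ext => x; rewrite !bopM.
apply: cvg_lim_eq (cvg_bop (TS x)) _.
have -> : (fun n => t (T n x)) = (fun n => T n (t x)); last exact: TS.
by apply/funext => n; rewrite -[LHS]/((t ** T n) x) tT.
Qed.

End RealNorm.

(** * Calculus in a star algebra *)

Section StarAlgebraCalculus.
Variables (K : numClosedFieldType) (A : starAlgType K).
Implicit Types a b c : A.

Lemma amul0l a : 0 ** a = 0.
Proof. by apply: (addIr (0 ** a)); rewrite -amulDl !add0r. Qed.
Lemma amul0r a : a ** 0 = 0.
Proof. by apply: (addIr (a ** 0)); rewrite -amulDr !add0r. Qed.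
Lemma amulNl a b : (- a) ** b = - (a ** b).
Proof. by apply: (addIr (a ** b)); rewrite -amulDl !addNr amul0l. Qed.
Lemma amulNr a b : a ** (- b) = - (a ** b).
Proof. by apply: (addIr (a ** b)); rewrite -amulDr !addNr amul0r. Qed.
Lemma amulBl a b c : (a - b) ** c = a ** c - b ** c.
Proof. by rewrite amulDl amulNl. Qed.
Lemma amulBr a b c : c ** (a - b) = c ** a - c ** b.
Proof. by rewrite amulDr amulNr. Qed.

Lemma amul_suml (I : Type) (r : seq I) (P : pred I) (F : I -> A) a :
  (\sum_(i <- r | P i) F i) ** a = \sum_(i <- r | P i) F i ** a.
Proof. by elim/big_rec2: _ => [|i y x _ <-]; rewrite ?amul0l ?amulDl. Qed.
Lemma amul_sumr (I : Type) (r : seq I) (P : pred I) (F : I -> A) a :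
  a ** (\sum_(i <- r | P i) F i) = \sum_(i <- r | P i) a ** F i.
Proof. by elim/big_rec2: _ => [|i y x _ <-]; rewrite ?amul0r ?amulDr. Qed.

Lemma star0 : star 0 = 0 :> A.
Proof. by apply: (addIr (star 0)); rewrite -starD !add0r. Qed.
Lemma starN a : star (- a) = - star a.
Proof. by apply: (addIr (star a)); rewrite -starD !addNr star0. Qed.
Lemma starB a b : star (a - b) = star a - star b.
Proof. by rewrite starD starN. Qed.
Lemma star1 : star aone = aone :> A.
Proof. by have := starM (star aone) (aone : A); rewrite amul1r starK amul1r. Qed.
Lemma star_sum (I : Type) (r : seq I) (P : pred I) (F : I -> A) :
  star (\sum_(i <- r | P i) F i) = \sum_(i <- r | P i) star (F i).
Proof. by elim/big_rec2: _ => [|i y x _ <-]; rewrite ?star0 ?starD. Qed.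

End StarAlgebraCalculus.

Lemma starZ_real (R : realType) (A : starAlgType R[i]) (t : R) (a : A) :
  star (t%:C%C *: a) = t%:C%C *: star a.
Proof. by rewrite starZ; congr (_ *: _); apply: conjc_real. Qed.

(** * Square roots by iteration *)

Section SquareRoot.
Variables (R : realType) (H : hilbertType R).
Implicit Types (x y z : H) (S T : bop H).

Definition positive_op T := star T = T /\ forall x, 0 <= rinner (T x) x.

Lemma nonincreasing_small_gap (b : nat -> R) (e : R) : 0 < e ->
  (forall n, b n.+1 <= b n) -> (forall n, 0 <= b n) ->
  exists N, forall m n, (N <= m)%N -> (N <= n)%N -> `|b m - b n| < e.
Proof.
move=> e0 b1 b0.
have mono m n : (m <= n)%N -> b n <= b m.
  by move/subnK <-; elim: (n - m)%N => // k IH; apply: le_trans (b1 _) IH.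
have hi : has_inf (range b).
  by split; [exists (b 0%N), 0%N | exists 0 => _ [n _ <-]].
have [_ [N _ <-] bN] := inf_adherent e0 hi.
exists N => m n Nm Nn.
have low k : inf (range b) <= b k.
  by apply: ge_inf; [case: hi | exists k].
have := low m; have := low n; have := mono _ _ Nm; have := mono _ _ Nn.
by move=> *; rewrite ltr_norml; apply/andP; split; lra.
Qed.

Section Contraction.
Variable k : bop H.
Hypothesis k1 : forall x, rnorm (k x) <= rnorm x.

Let half : R[i] := (2^-1 : R)%:C%C.

Fixpoint root_iter n : bop H :=
  if n is m.+1 then half *: (k + root_iter m ** root_iter m) else 0.

Fixpoint root_bound n : R :=
  if n is m.+1 then 2^-1 * (1 + root_bound m ^+ 2) else 0.

Lemma root_iter_comm (t : bop H) n : t ** k = k ** t ->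
  t ** root_iter n = root_iter n ** t.
Proof.
move=> tk; elim: n => [|n IH] /=; first by rewrite amul0l amul0r.
by rewrite amulZl amulZr amulDl amulDr tk amulA IH -!amulA IH.
Qed.

Lemma root_iter_sa n : star k = k -> star (root_iter n) = root_iter n.
Proof.
by move=> sk; elim: n => [|n IH] /=; rewrite ?star0 // starZ_real starD starM sk IH.
Qed.

Lemma root_bound_itv n : 0 <= root_bound n <= 1.
Proof. by elim: n => [|n /andP[a b]] /=; [lra | apply/andP; split; nra]. Qed.

Lemma root_bound_incr n : root_bound n <= root_bound n.+1.
Proof.
elim: n => [|n IH] /=; first by rewrite expr2; lra.
have /andP[a b] := root_bound_itv n; have /andP[] := root_bound_itv n.+1.
move: IH => /=; nra.
Qed.

Lemma root_iter_norm n x : rnorm (root_iter n x) <= root_bound n * rnorm x.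
Proof.
elim: n x => [|n IH] x /=; first by rewrite mul0r rnorm0.
rewrite rnorm_scale ?invr_ge0 // -mulrA ler_wpM2l ?invr_ge0 //.
apply: le_trans (rnormD _ _) _; rewrite mulrDl mul1r lerD // expr2 -mulrA.
apply: le_trans (IH _) _; rewrite ler_wpM2l //.
by case/andP: (root_bound_itv n).
Qed.

(** The iterates y_n commute, so y_(n+2) - y_(n+1) is
    1/2 (y_(n+1) + y_n) (y_(n+1) - y_n); the scalar iteration, which is the case
    k = 1, obeys the same recursion and therefore dominates. *)
Lemma root_iter_step n x :
  rnorm (root_iter n.+1 x - root_iter n x)
    <= (root_bound n.+1 - root_bound n) * rnorm x.
Proof.
elim: n x => [|n IH] x.
  by have := root_iter_norm 1 x; rewrite bop0 /= !subr0.
set y1 := root_iter n.+1; set y0 := root_iter n.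
have cm : y1 ** y0 = y0 ** y1.
  by apply: root_iter_comm; rewrite -root_iter_comm.
have -> : root_iter n.+2 x - y1 x = half *: (y1 + y0) ((y1 - y0) x).
  rewrite -[LHS]/((root_iter n.+2 - y1) x) -bopM -bopZ; congr bop_fun.
  have -> : root_iter n.+2 - y1 = half *: (k + y1 ** y1) - half *: (k + y0 ** y0).
    by [].
  rewrite -scalerBr; congr (_ *: _).
  by rewrite amulBr !amulDl cm [k + y1 ** y1]addrC !addrKA.
rewrite rnorm_scale ?invr_ge0 //.
have -> : root_bound n.+2 - root_bound n.+1 =
  2^-1 * ((root_bound n.+1 + root_bound n) * (root_bound n.+1 - root_bound n)).
  by rewrite /=; field.
rewrite -!mulrA ler_wpM2l ?invr_ge0 //.
have /andP[a0 _] := root_bound_itv n; have /andP[a1 _] := root_bound_itv n.+1.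
set z := (y1 - y0) x.
apply: (@le_trans _ _ ((root_bound n.+1 + root_bound n) * rnorm z)).
  rewrite bopD mulrDl; apply: le_trans (rnormD _ _) _.
  by rewrite lerD // root_iter_norm.
by rewrite ler_wpM2l ?addr_ge0 //; apply: IH.
Qed.

Lemma root_iter_dist m n x : (n <= m)%N ->
  rnorm (root_iter m x - root_iter n x) <= (root_bound m - root_bound n) * rnorm x.
Proof.
move/subnK <-; elim: (m - n)%N => [|j IH].
  by rewrite add0n !subrr mul0r rnorm0.
have := root_iter_step (j + n) x; rewrite addSn.
have := rnormD (root_iter (j + n).+1 x - root_iter (j + n) x)
  (root_iter (j + n) x - root_iter n x).
rewrite addrA subrK => h1 h2; apply: le_trans h1 _.
apply: le_trans (lerD h2 IH) _; lra.
Qed.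

(** The increments of y_n are dominated by those of an increasing scalar sequence
    bounded by 1, so y = lim y_n exists strongly.  The fixed point equation says
    (1 - y)^2 = 1 - k. *)
Lemma contraction_root : exists y : bop H,
  [/\ forall x, rnorm (y x) <= rnorm x,
      half *: (k + y ** y) = y,
      star k = k -> star y = y
    & forall t, t ** k = k ** t -> t ** y = y ** t].
Proof.
have bnd n x : rnorm (root_iter n x) <= 1 * rnorm x.
  apply: le_trans (root_iter_norm n x) _.
  by rewrite ler_wpM2r ?rnorm_ge0 //; case/andP: (root_bound_itv n).
have [x|y yl] := strong_limit bnd.
  apply: cauchy_cvg_rnorm => e e0.
  have x1 : 0 < rnorm x + 1 by have := rnorm_ge0 x; lra.
  have [|n|n|N NP] := @nonincreasing_small_gap (fun n => 1 - root_bound n)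
      (e / (rnorm x + 1)); last 1 first.
  - exists N => m n Nm Nn.
    wlog nm : m n Nm Nn / (n <= m)%N.
      move=> W; case/orP: (leq_total n m) => ?; first exact: W.
      by rewrite rnorm_distC; apply: W.
    apply: le_lt_trans (root_iter_dist x nm) _.
    have := NP m n Nm Nn; rewrite ltr_pdivlMr ?divr_gt0 //; apply: le_lt_trans.
    rewrite ler_pM ?rnorm_ge0 ?subr_ge0 //; last by lra.
      move/subnK: nm <-; elim: (m - n)%N => // j IH.
      by apply: le_trans IH _; apply: root_bound_incr.
    have -> : 1 - root_bound m - (1 - root_bound n) = - (root_bound m - root_bound n).
      by ring.
    by rewrite normrN ler_norm.
  - by rewrite divr_gt0.
  - by rewrite lerD2l lerN2; apply: root_bound_incr.
  - by rewrite subr_ge0; case/andP: (root_bound_itv n).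
exists y; split.
- move=> x; apply: rnorm_cvg_le (yl x) _ => n.
  by have := bnd n x; rewrite mul1r.
- apply: bop_ext => x; apply: cvg_lim_eq (_ : (fun n => root_iter n.+1 x) @ \oo --> _) _.
    rewrite bopZ bopD; apply: cvgZl_tmp; apply: cvgD; first exact: cvg_cst.
    (* products of strongly convergent contractions converge strongly *)
    have -> : (fun n => (root_iter n ** root_iter n) x) =
      (fun n => root_iter n (root_iter n x - y x) + root_iter n (y x)).
      by apply/funext => n; rewrite -bop_additive subrK.
    rewrite -[X in _ --> X]add0r; apply: cvgD; last exact: yl.
    apply: (cvg_rnorm_le (w := fun n => rnorm (root_iter n x - y x))).
      by move=> n; rewrite subr0; have := bnd n (root_iter n x - y x); rewrite mul1r.
    exact/cvg_rnorm_dist/yl.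
  by have := yl x; rewrite -(cvg_shiftS (fun n => root_iter n x)).
- by move=> sk; apply: strong_limit_sa yl => n; apply: root_iter_sa.
- by move=> t tk; apply: strong_limit_comm yl => n; apply: root_iter_comm.
Qed.

End Contraction.
End SquareRoot.

(** * Supports of positive operators *)

Section RootSupport.
Variables (R : realType) (H : hilbertType R).
Implicit Types (x y z : H) (s e g t : bop H).

Definition op_pow (y : bop H) n : bop H := iter n (amul y) aone.

Lemma op_powS (y : bop H) n : op_pow y n.+1 = y ** op_pow y n.
Proof. by []. Qed.

Lemma op_powSr (y : bop H) n : op_pow y n.+1 = op_pow y n ** y.
Proof.
elim: n => [|n IH]; first by rewrite /op_pow /= amul1l amul1r.
by rewrite op_powS {1}IH amulA -op_powS.
Qed.

Lemma op_pow_sa (y : bop H) n : star y = y -> star (op_pow y n) = op_pow y n.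
Proof.
move=> sy; elim: n => [|n IH]; first exact: star1.
by rewrite op_powS starM IH sy -op_powSr.
Qed.

Lemma op_pow_contraction (y : bop H) : (forall x, rnorm (y x) <= rnorm x) ->
  forall n x, rnorm (op_pow y n x) <= rnorm x.
Proof.
by move=> y1; elim=> [|n IH] x; [exact: lexx | apply: le_trans (y1 _) (IH x)].
Qed.

Lemma op_pow_fix (y : bop H) n x : y x = x -> op_pow y n x = x.
Proof. by move=> yx; elim: n => [|n IH] //; rewrite op_powS bopM IH. Qed.

Lemma op_pow_rinner (y : bop H) i j x z : star y = y ->
  rinner (op_pow y i x) (op_pow y j z) = rinner (op_pow y (i + j) x) z.
Proof.
move=> sy; elim: j i => [|j IH] i; first by rewrite addn0.
by rewrite addnS -addSn -IH !op_powS !bopM (rinner_sa _ _ sy).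
Qed.

(** The inner products of y^(2m) x and y^(2n) x only depend on m + n, so that
    |y^(2m) x - y^(2n) x|^2 = b_(2m) + b_(2n) - 2 b_(m+n) with b_j = |y^j x|^2
    nonincreasing. *)
Lemma even_power_limit (y : bop H) : star y = y ->
  (forall x, rnorm (y x) <= rnorm x) ->
  exists q : bop H, forall x, (fun n => op_pow y n.*2 x) @ \oo --> q x.
Proof.
move=> sy y1; have pc := op_pow_contraction y1.
apply: (@strong_limit _ _ _ 1) => [n x|x]; first by rewrite mul1r.
apply: cauchy_cvg_rnorm => e e0.
pose b j := rnorm (op_pow y j x) ^+ 2.
have [||n|N NP] := @nonincreasing_small_gap _ b (e ^+ 2 / 2).
- by rewrite divr_gt0 ?exprn_gt0.
- by move=> n; rewrite /b ler_pXn2r ?nnegrE ?rnorm_ge0 //; apply: y1.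
- exact: sqr_ge0.
exists N => m n Nm Nn.
rewrite -(@ltr_pXn2r _ 2) ?nnegrE ?rnorm_ge0 ?(ltW e0) //.
have -> : rnorm (op_pow y m.*2 x - op_pow y n.*2 x) ^+ 2 =
    (b m.*2 - b (m + n)%N) + (b n.*2 - b (m + n)%N).
  have -> : b (m + n)%N = rinner (op_pow y m.*2 x) (op_pow y n.*2 x).
    by rewrite /b -rinner_norm !op_pow_rinner // -!addnn addnACA.
  by rewrite rnormD2 rnormN rinnerNr /b; ring.
have N2 i : (N <= i)%N -> (N <= i.*2)%N.
  by move=> Ni; apply: leq_trans Ni _; rewrite -addnn leq_addr.
have Nmn : (N <= m + n)%N by apply: leq_trans Nm _; rewrite leq_addr.
have := NP _ _ (N2 _ Nm) Nmn; have := NP _ _ (N2 _ Nn) Nmn.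
by rewrite !ltr_norml => /andP[_ +] /andP[_ +]; lra.
Qed.

(** The projection e is the support of the self-adjoint operator s.  The last
    clause is a substitute for the unbounded inverse of s on its range: s u_n
    tends strongly to the projection e onto the closure of that range. *)
Definition support_of s e : Prop :=
  [/\ star s = s, projection e, s ** e = s, forall x, s x = 0 -> e x = 0
    & exists (u : nat -> bop H) (K : R),
        (forall n x, rnorm (s (u n x)) <= K * rnorm x) /\
        (forall x, (fun n => s (u n x)) @ \oo --> e x)].

(** e = 1 - lim y^(2n), with u_n = 1 + y + ... + y^(2n - 1). *)
Lemma support_one_sub (y : bop H) : positive_op y ->
  (forall x, rnorm (y x) <= rnorm x) -> exists e, support_of (aone - y) e.
Proof.
move=> [sy y0] y1; have [q ql] := even_power_limit sy y1.
have pc := op_pow_contraction y1.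
have sq : star q = q by apply: strong_limit_sa ql => n; apply: op_pow_sa.
(* y^2 q = q gives y w = - w for w = q x - y q x, so w = 0 as y >= 0 *)
have yq x : y (q x) = q x.
  have yyq : y (y (q x)) = q x.
    apply: cvg_lim_eq (cvg_bop (cvg_bop (ql x))) _.
    by have := ql x; rewrite -(cvg_shiftS (fun n => op_pow y n.*2 x)).
  set w := q x - y (q x).
  have yw : y w = - w by rewrite /w bop_additive bop_opp yyq opprB.
  apply/esym/eqP; rewrite -subr_eq0; apply/eqP/rnorm2_eq0.
  by rewrite -rinner_norm; have := y0 w; rewrite yw rinnerNl oppr_ge0.
have qfix x : y x = x -> q x = x.
  move=> yx; apply: cvg_lim_eq (ql x) _.
  under eq_fun do rewrite op_pow_fix //.
  exact: cvg_cst.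
have qq : q ** q = q by apply: bop_ext => x; rewrite bopM qfix.
pose u n : bop H := \sum_(j < n.*2) op_pow y j.
have su n : (aone - y) ** u n = aone - op_pow y n.*2.
  rewrite /u; elim: n.*2 => [|m IH]; first by rewrite big_ord0 amul0r subrr.
  by rewrite big_ord_recr amulDr IH /= amulBl amul1l -op_powS addrA subrK.
have suE n x : (aone - y) (u n x) = x - op_pow y n.*2 x by rewrite -bopM su.
exists (aone - q); split.
- by rewrite starB star1 sy.
- split; last by rewrite starB star1 sq.
  by rewrite amulBl !amulBr !amul1l amul1r qq subrr subr0.
- rewrite amulBr amul1r amulBl amul1l.
  have -> : y ** q = q by apply: bop_ext => x; rewrite bopM yq.
  by rewrite subrr subr0.
- move=> x; rewrite !bopD !bopN => /eqP; rewrite subr_eq0 => /eqP xy.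
  by rewrite qfix ?subrr.
exists u, 2; split=> [n x|x].
  rewrite suE; apply: le_trans (rnormD _ _) _; rewrite rnormN.
  by have := pc n.*2 x; lra.
under eq_fun do rewrite suE.
by rewrite bopD bopN; apply: cvgB; [exact: cvg_cst | exact: ql].
Qed.

Lemma support_scale (c : R) s e : 0 < c ->
  support_of s e -> support_of (c%:C%C *: s) e.
Proof.
move=> c0 [ss pe se ker [u [K [uK ul]]]]; split=> //.
- by rewrite starZ_real ss.
- by rewrite amulZl se.
- move=> x /eqP; rewrite bopZ scaler_eq0 => /orP[|/eqP]; last exact: ker.
  by rewrite (fmorph_eq0 (real_complex R)) gt_eqF.
exists (fun n => (c^-1)%:C%C *: u n), K.
have e1 n x : (c%:C%C *: s) (((c^-1)%:C%C *: u n) x) = s (u n x).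
  rewrite !bopZ bop_scalable scalerA -rmorphM divff ?gt_eqF //.
  by rewrite rmorph1 scale1r.
split=> [n x|x]; first by rewrite e1.
by under eq_fun do rewrite e1; apply: ul.
Qed.

(** Expand (g z, z) >= 0 at z = C x - g x, where (g g x, g x) <= C |g x|^2. *)
Lemma positive_op_norm g (C : R) x : positive_op g -> 0 < C ->
  (forall z, rnorm (g z) <= C * rnorm z) ->
  rnorm (g x) ^+ 2 <= C * rinner (g x) x.
Proof.
move=> [sg g0] C0 gC; set a := g x.
have := g0 (C%:C%C *: x - a).
rewrite bop_additive bop_scalable bop_opp !rinnerDl !rinnerDr !rinnerNl !rinnerNr.
rewrite !rinnerZl !rinnerZr -/a (rinner_sa _ _ sg) rinner_norm.
have : rinner (g a) a <= C * rnorm a ^+ 2.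
  apply: le_trans (rinner_le _ _) _; rewrite expr2 mulrA.
  by rewrite ler_wpM2r ?rnorm_ge0.
set p := rnorm a ^+ 2; set r := rinner a x; set v := rinner (g a) a.
move=> h1 h2; rewrite -(ler_pM2l C0); lra.
Qed.

(** With 0 <= g <= C, the operator k = 1 - g / C is a positive contraction, so
    that y = 1 - (1 - k)^(1/2) is one too; the root of g is C^(1/2) (1 - y). *)
Lemma positive_root g : positive_op g ->
  exists s e, [/\ support_of s e, s ** s = g
    & forall t, t ** g = g ** t -> t ** s = s ** t].
Proof.
move=> pg; have [sg g0] := pg; have [C C0 gC] := bop_rbound g.
have gn x := positive_op_norm x pg C0 gC.
pose k : bop H := aone - (C^-1)%:C%C *: g.
have kE x : k x = x - (C^-1)%:C%C *: g x by [].
have sk : star k = k by rewrite starB star1 starZ_real sg.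
have k1 x : rnorm (k x) <= rnorm x.
  rewrite -(@ler_pXn2r _ 2) ?nnegrE ?rnorm_ge0 // kE rnormD2 rnormN rnormZ.
  rewrite rinnerNr rinnerZr rinnerC.
  have : C^-1 ^+ 2 * rnorm (g x) ^+ 2 <= C^-1 * rinner (g x) x.
    rewrite expr2 -mulrA ler_wpM2l ?invr_ge0 ?(ltW C0) //.
    by rewrite ler_pdivrMl.
  have : 0 <= C^-1 * rinner (g x) x by rewrite mulr_ge0 ?invr_ge0 ?(ltW C0).
  by lra.
have k0 x : 0 <= rinner (k x) x.
  rewrite kE rinnerDl rinnerNl rinnerZl rinner_norm subr_ge0 ler_pdivrMl //.
  apply: le_trans (rinner_le _ _) _.
  by rewrite expr2 mulrA ler_wpM2r ?rnorm_ge0.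
have [y [y1 yE /(_ sk) sy yc]] := contraction_root k1.
have py : positive_op y.
  split=> // x; rewrite -yE bopZ bopD bopM rinnerZl rinnerDl (rinner_sa _ _ sy).
  rewrite rinner_norm mulr_ge0 ?invr_ge0 // addr_ge0 ?k0 // sqr_ge0 //.
have [e se] := support_one_sub py y1.
exists ((Num.sqrt C)%:C%C *: (aone - y)), e; split.
- by apply: support_scale se; rewrite sqrtr_gt0.
- rewrite amulZl amulZr scalerA -rmorphM -expr2 sqr_sqrtr ?(ltW C0) //.
  have kyy : y + y = k + y ** y.
    rewrite -[in LHS]yE -scalerDl -rmorphD -[RHS]scale1r; congr (_ *: _).
    by rewrite -(rmorph1 (real_complex R)) /=; congr (_%:C%C); lra.
  have -> : (aone - y) ** (aone - y) = aone - k.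
    rewrite amulBl !amulBr !amul1l amul1r.
    have -> : y ** y = y + y - k by rewrite kyy addrC addKr.
    by rewrite opprB [y + y - k]addrAC addrK addrA subrK.
  rewrite /k opprB addrC subrK scalerA -rmorphM divff ?gt_eqF //.
  by rewrite rmorph1 scale1r.
- move=> t tg; rewrite amulZl amulZr amulBl amulBr amul1l amul1r yc //.
  by rewrite amulBl amulBr amul1l amul1r amulZl amulZr tg.
Qed.

End RootSupport.

(** * Factorisation through an operator and its support *)

Section Factorization.
Variables (R : realType) (H : hilbertType R).
Implicit Types (x y z : H) (s e d t v w f : bop H).

Lemma support_projM s e : support_of s e -> e ** s = s.
Proof. by move=> [ss [_ se] se1 _ _]; rewrite -{1}ss -{1}se -starM se1 ss. Qed.

Lemma support_ker s e v : support_of s e -> s ** v = 0 -> e ** v = 0.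
Proof.
move=> [_ _ _ ker _] sv; apply: bop_ext => x; apply: ker.
by rewrite -bopM sv.
Qed.

Lemma support_cancel s e v : support_of s e -> v ** e = v -> v ** s = 0 -> v = 0.
Proof.
move=> se ve vs; have [ss [_ es] _ _ _] := se.
have -> : v = star (e ** star v) by rewrite starM starK es.
rewrite (support_ker se) ?star0 //.
by rewrite -{1}ss -starM vs star0.
Qed.

Lemma support_cancel2 s e v : support_of s e -> e ** v ** e = v ->
  s ** v ** s = 0 -> v = 0.
Proof.
move=> se eve svs; have [_ [ee _] _ _ _] := se.
rewrite -eve; apply: (support_cancel se).
  by rewrite -amulA ee.
by rewrite -!amulA (support_projM se) (support_ker se) // amulA.
Qed.

Lemma sandwich_inj s e v w : support_of s e -> e ** v ** e = v ->
  e ** w ** e = w -> s ** v ** s = s ** w ** s -> v = w.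
Proof.
move=> se ve we sv; apply/eqP; rewrite -subr_eq0; apply/eqP.
apply: (support_cancel2 se); first by rewrite amulBr amulBl ve we.
by rewrite amulBr amulBl sv subrr.
Qed.

(** Since t commutes with s, it leaves the common kernel of s and e invariant;
    for the other half of the commutation this is applied to t^*. *)
Lemma support_comm s e t : support_of s e ->
  t ** s = s ** t -> star t ** s = s ** star t -> t ** e = e ** t.
Proof.
move=> se; have [ss [ee es] se1 _ _] := se.
have half v : v ** s = s ** v -> e ** v = e ** v ** e.
  move=> vs; apply/eqP; rewrite -subr_eq0 -amulA -amulBr; apply/eqP.
  apply: (support_ker se).
  by rewrite amulBr [s ** (v ** e)]amulA -vs -amulA se1 vs subrr.
move=> /half h1 /half/(congr1 star); rewrite !starM starK es => ->.
by rewrite amulA -h1.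
Qed.

Lemma le_of_sqr_le (r b : R) : 0 <= b -> r ^+ 2 <= b * r -> r <= b.
Proof. by move=> b0 rb; case: leP => // br; nra. Qed.

(** Douglas' lemma: w = lim d u_n, a limit that exists because |d z| <= K |s z|
    and s u_n converges. *)
Lemma douglas s e d (K : R) : support_of s e ->
  (forall x, rnorm (d x) <= K * rnorm (s x)) ->
  exists w, w ** s = d /\ w ** e = w.
Proof.
move=> se dK0; have [_ [ee _] _ _ [u [L [uL ul]]]] := se.
have dK x : rnorm (d x) <= `|K| * rnorm (s x).
  by apply: le_trans (dK0 x) _; rewrite ler_wpM2r ?rnorm_ge0 ?ler_norm.
have [||w wl] := @strong_limit _ _ (fun n => d ** u n) (`|K| * L).
- move=> n x; apply: le_trans (dK _) _; rewrite -mulrA ler_wpM2l //.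
- move=> x; apply: cauchy_cvg_rnorm => eps eps0.
  have K1 : 0 < 2 * (`|K| + 1) by rewrite mulr_gt0 // ltr_wpDl.
  have /cvg_rnormP/(_ (eps / (2 * (`|K| + 1))))[|N NP] := ul x.
    by rewrite divr_gt0.
  exists N => m n /NP + /NP; rewrite !ltr_pdivlMr // => h1 h2.
  rewrite !bopM -bop_opp -bop_additive; apply: le_lt_trans (dK _) _.
  rewrite bop_additive bop_opp.
  have := rnormD (s (u m x) - e x) (e x - s (u n x)).
  rewrite addrA subrK [rnorm (e x - _)]rnorm_distC.
  set a := rnorm (_ - _ : H); have := rnorm_ge0 (s (u m x) - s (u n x)).
  have : 0 <= `|K| by [].
  rewrite -/a; move: h1 h2.
  set b := rnorm _; set c := rnorm _; set k := `|K|; nra.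
exists (w ** e); split; last by rewrite -amulA ee.
rewrite -amulA (support_projM se); apply: bop_ext => x; rewrite bopM.
apply: cvg_lim_eq (wl (s x)) _.
apply: (cvg_rnorm_le (w := fun n => `|K| * rnorm (s (u n (s x)) - s x))).
  by move=> n; rewrite !bopM -bop_opp -bop_additive -bop_opp -bop_additive.
rewrite -(mulr0 `|K|); apply: cvgMl_tmp; apply: cvg_rnorm_dist.
by have := ul (s x); rewrite -[e (s x)]bopM (support_projM se).
Qed.

(** Taking y = f x in the bound gives |f x| <= K' |s x|, so f = d s; since
    d x = lim f u_n x, the bound passes to |(d x, y)| <= K'' |x| |s y|, which
    says |d^* y| <= K'' |s y| and lets d^* be factored in turn. *)
Lemma sandwich_factor s e f (K : R) : support_of s e -> 0 <= K ->
  (forall x y, rinner (f x) y <= K * (rnorm (s x) * rnorm (s y))) ->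
  exists t, s ** t ** s = f /\ e ** t ** e = t.
Proof.
move=> se K0 fK; have [ss [ee es] se1 _ [u [L0 [uL0 ul]]]] := se.
have [L L1 uL] : exists2 L, 0 <= L & forall n x, rnorm (s (u n x)) <= L * rnorm x.
  exists `|L0| => // n x; apply: le_trans (uL0 n x) _.
  by rewrite ler_wpM2r ?rnorm_ge0 ?ler_norm.
have [c c0 sc] := bop_rbound s.
have [x|d [ds de]] := @douglas s e f (K * c) se.
  apply: le_of_sqr_le; first by rewrite !mulr_ge0 ?rnorm_ge0 ?(ltW c0).
  rewrite -rinner_norm; apply: le_trans (fK _ _) _.
  by rewrite -!mulrA ler_wpM2l // [c * _]mulrCA ler_wpM2l ?rnorm_ge0.
have [y|w [ws we]] := @douglas s e (star d) (K * L) se.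
  apply: le_of_sqr_le; first by rewrite !mulr_ge0 ?rnorm_ge0.
  rewrite -rinner_norm -rinner_adjr; set x := star d y.
  have dl : (fun n => d (s (u n x))) @ \oo --> d x.
    by rewrite -{2}de bopM; apply: cvg_bop.
  rewrite rinnerC; apply: (rinner_cvg_le dl) => n.
  rewrite -bopM ds; apply: le_trans (fK _ _) _.
  rewrite -!mulrA ler_wpM2l // [rnorm (s y) * _]mulrC mulrA.
  by rewrite ler_wpM2r ?rnorm_ge0.
have dsw : s ** star w = d by rewrite -[d]starK -ws starM ss.
exists (star w ** e); split; last first.
  by rewrite amulA -!amulA ee amulA -{1}es -starM we.
by rewrite amulA -[_ ** e ** s]amulA (support_projM se) dsw.
Qed.

End Factorization.

(** * Closure properties of a von Neumann algebra *)

Section VonNeumann.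
Variables (R : realType) (H : hilbertType R) (M : set (bop H)).
Hypothesis hM : von_neumann_algebra M.
Implicit Types (s e d t v w f : bop H).

Lemma vn_mem v : (forall t, commutant M t -> t ** v = v ** t) -> M v.
Proof. by have [_ MM] := hM; rewrite -{2}MM. Qed.

Lemma vnM v w : M v -> M w -> M (v ** w).
Proof. by have [[_ _ + _] _] := hM; apply. Qed.

Lemma vn_star v : M v -> M (star v).
Proof. by have [[_ _ _ +] _] := hM; apply. Qed.

Lemma vn0 : M 0.
Proof. by have [[]] := hM. Qed.

Lemma vnD v w : M v -> M w -> M (v + w).
Proof. by have [[_ Ml _ _] _] := hM => /(Ml 1)/[apply]; rewrite scale1r. Qed.

Lemma vnB v w : M v -> M w -> M (v - w).
Proof.
have [[_ Ml _ _] _] := hM => Mv Mw.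
by rewrite addrC -scaleN1r; apply: Ml.
Qed.

Lemma vn_sum (I : Type) (r : seq I) (P : pred I) (F : I -> bop H) :
  (forall i, P i -> M (F i)) -> M (\sum_(i <- r | P i) F i).
Proof. by move=> MF; apply: big_ind => //; [exact: vn0 | exact: vnD]. Qed.

Lemma commutant_star t : commutant M t -> commutant M (star t).
Proof.
move=> tM v Mv; have := tM _ (vn_star Mv) => /(congr1 star).
by rewrite !starM starK.
Qed.

Lemma vn_root g s : M g -> (forall t, t ** g = g ** t -> t ** s = s ** t) -> M s.
Proof. by move=> Mg gs; apply: vn_mem => t tM; apply: gs; rewrite tM. Qed.

Lemma vn_support s e : support_of s e -> M s -> M e.
Proof.
move=> se Ms; apply: vn_mem => t tM; apply: (support_comm se); rewrite -?tM //.
by rewrite (commutant_star tM).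
Qed.

(** For t in the commutant of M, the commutator of t and w is killed by s on the
    right, hence vanishes by cancellation. *)
Lemma vn_douglas s e w : support_of s e -> M s -> w ** e = w -> M (w ** s) -> M w.
Proof.
move=> se Ms we Mws; apply: vn_mem => t tM.
have te : t ** e = e ** t by rewrite (tM _ (vn_support se Ms)).
apply/eqP; rewrite -subr_eq0; apply/eqP/(support_cancel se).
  by rewrite amulBl -!amulA we te amulA we.
by rewrite amulBl -!amulA -(tM _ Mws) -(tM _ Ms) amulA subrr.
Qed.

Lemma vn_sandwich s e t : support_of s e -> M s -> e ** t ** e = t ->
  M (s ** t ** s) -> M t.
Proof.
move=> se Ms ete Msts; apply: vn_mem => v vM.
have ve : v ** e = e ** v by rewrite (vM _ (vn_support se Ms)).
have vs : v ** s = s ** v by rewrite (vM _ Ms).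
apply/eqP; rewrite -subr_eq0; apply/eqP/(support_cancel2 se).
  rewrite amulBr amulBl; congr (_ - _).
    by rewrite amulA -ve -!amulA [e ** (t ** e)]amulA ete.
  by rewrite -!amulA ve !amulA ete.
rewrite amulBr amulBl; apply/eqP; rewrite subr_eq0; apply/eqP.
transitivity (v ** (s ** t ** s)); first by rewrite !amulA vs.
by rewrite -(vM _ Msts) -!amulA vs.
Qed.

Lemma in_corner e v : M v -> e ** v ** e = v -> corner e M v.
Proof. by move=> Mv eve; exists v. Qed.

End VonNeumann.

(** * The Gram-Schmidt process *)

Section GramSchmidt.
Variables (R : realType) (H : hilbertType R) (M : set (bop H)) (e : bop H).
Hypothesis hM : von_neumann_algebra M.
Hypothesis pe : projection e.

Definition gram m n (W : 'I_m -> 'I_n -> bop H) i j : bop H :=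
  \sum_k star (W k i) ** W k j.

Lemma gram_positive m n (W : 'I_m -> 'I_n -> bop H) j : positive_op (gram W j j).
Proof.
split.
  by rewrite star_sum; apply: eq_bigr => k _; rewrite starM starK.
move=> x; rewrite /gram bop_sum; elim/big_ind: _ => [|a b a0 b0|k _].
- by rewrite linear0l.
- by rewrite rinnerDl addr_ge0.
- by rewrite bopM -rinner_adjr rinner_norm sqr_ge0.
Qed.

Lemma gram_norm m n (W : 'I_m -> 'I_n -> bop H) j k x :
  rnorm (W k j x) ^+ 2 <= rinner (gram W j j x) x.
Proof.
rewrite /gram (bigD1 k) // bopD rinnerDl bopM -rinner_adjr rinner_norm lerDl.
rewrite bop_sum; elim/big_ind: _ => [|a b a0 b0|i _].
- by rewrite linear0l.
- by rewrite rinnerDl addr_ge0.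
- by rewrite bopM -rinner_adjr rinner_norm sqr_ge0.
Qed.

Definition in_left_ideal m n (W : 'I_m -> 'I_n -> bop H) :=
  forall k j, M (W k j) /\ W k j ** e = W k j.

(** One step of the Gram-Schmidt process: with r = |W_j0| the modulus of the
    column j0 and W_j0 = U r its polar decomposition, the row U^* W splits off
    and the remainder W - U U^* W has column j0 equal to zero. *)
Lemma gram_schmidt_step m n (W : 'I_m -> 'I_n -> bop H) (j0 : 'I_n) :
  in_left_ideal W ->
  exists (row : 'I_n -> bop H) (V : 'I_m -> 'I_n -> bop H),
    [/\ forall j, corner e M (row j), in_left_ideal V, forall k, V k j0 = 0,
        forall j, (forall k, W k j = 0) -> forall k, V k j = 0
      & forall i j, gram W i j = star (row i) ** row j + gram V i j].
Proof.
move=> cW; have [ee es] := pe.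
have [r [er [sr rr rc]]] := positive_root (gram_positive W j0).
have [sar [erer ers] rer _ _] := sr.
have Mr : M r.
  apply: (vn_root hM) rc; apply: (vn_sum hM) => k _.
  by have [MW _] := cW k j0; apply: (vnM hM) => //; apply: (vn_star hM).
have Mer : M er := vn_support hM sr Mr.
have rnormr x : rinner (gram W j0 j0 x) x = rnorm (r x) ^+ 2.
  by rewrite -rr bopM (rinner_sa _ _ sar) rinner_norm.
have /choice[U UP] k : exists w, w ** r = W k j0 /\ w ** er = w.
  apply: (@douglas _ _ r er (W k j0) 1 sr) => x.
  rewrite mul1r -(@ler_pXn2r _ 2) ?nnegrE ?rnorm_ge0 //.
  by rewrite -rnormr gram_norm.
have Ur k : U k ** r = W k j0 by case: (UP k).
have Uer k : U k ** er = U k by case: (UP k).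
have MU k : M (U k).
  by apply: (vn_douglas hM sr Mr (Uer k)); rewrite Ur; case: (cW k j0).
(* the support of r lies under e, since every W_(k, j0) kills 1 - e *)
have re : r ** (aone - e) = 0.
  apply: bop_ext => x; apply: rnorm2_eq0; rewrite bopM -rnormr /gram bop_sum.
  rewrite big1 ?linear0l // => k _; rewrite bopM -[W k j0 _]bopM.
  have [_ We] := cW k j0.
  by rewrite amulBr amul1r We subrr bop0 bop_at0.
have ere : er ** e = er.
  have := support_ker sr re; rewrite amulBr amul1r => /eqP.
  by rewrite subr_eq0 => /eqP.
have Ue k : U k ** e = U k by rewrite -Uer -amulA ere.
have UU : \sum_k star (U k) ** U k = er.
  apply/eqP; rewrite -subr_eq0; apply/eqP/(support_cancel2 sr).
    rewrite amulBr amulBl !erer; congr (_ - _).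
    rewrite amul_sumr amul_suml; apply: eq_bigr => k _.
    by rewrite amulA -{1}ers -starM Uer -amulA Uer.
  rewrite amulBr amulBl rer rr /gram; apply/eqP; rewrite subr_eq0; apply/eqP.
  rewrite amul_sumr amul_suml; apply: eq_bigr => k _.
  by rewrite amulA -{1}sar -starM Ur -amulA Ur.
pose row j := \sum_k star (U k) ** W k j.
have row_er j : er ** row j = row j.
  rewrite amul_sumr; apply: eq_bigr => k _.
  by rewrite amulA -{1}ers -starM Uer.
have Mrow j : M (row j).
  apply: (vn_sum hM) => k _; have [MW _] := cW k j.
  by apply: (vnM hM) => //; apply: (vn_star hM).
have row_e j : e ** row j ** e = row j.
  rewrite amul_sumr amul_suml; apply: eq_bigr => k _.
  have [_ We] := cW k j.
  by rewrite amulA -{1}es -starM Ue -amulA We.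
exists row, (fun k j => W k j - U k ** row j); split.
- by move=> j; apply: in_corner.
- move=> k j; have [MW We] := cW k j; split.
    by apply: (vnB hM) => //; apply: (vnM hM).
  by rewrite amulBl We -amulA -(row_e j) -(amulA _ e e) ee.
- move=> k; have -> : row j0 = r.
    transitivity (er ** r); last exact: support_projM sr.
    rewrite -UU amul_suml; apply: eq_bigr => i _.
    by rewrite -amulA Ur.
  by rewrite Ur subrr.
- move=> j W0 k; rewrite W0 /row big1 ?amul0r ?subrr // => i _.
  by rewrite W0 amul0r.
- move=> i j.
  have cross i' j' : \sum_k star (W k i') ** (U k ** row j') = star (row i') ** row j'.
    rewrite star_sum amul_suml; apply: eq_bigr => k _.
    by rewrite starM starK amulA.
  have cross' : \sum_k star (U k ** row i) ** W k j = star (row i) ** row j.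
    rewrite [X in _ ** X]/row amul_sumr; apply: eq_bigr => k _.
    by rewrite starM amulA.
  have quad : \sum_k star (U k ** row i) ** (U k ** row j) = star (row i) ** row j.
    rewrite -{2}(row_er j) -UU amul_suml amul_sumr; apply: eq_bigr => k _.
    by rewrite starM !amulA.
  have -> : gram (fun k j => W k j - U k ** row j) i j =
      gram W i j - star (row i) ** row j.
    rewrite /gram; under eq_bigr do rewrite starB amulBl !amulBr.
    by rewrite !sumrB cross cross' quad subrr subr0.
  by rewrite addrC subrK.
Qed.

(** Splitting off the columns one after the other exhausts W after n steps, and
    the n rows collected on the way form a square matrix over e M e, however many
    rows W has; only polar decompositions in M itself are involved. *)
Lemma gram_schmidt m n (W : 'I_m -> 'I_n -> bop H) : in_left_ideal W ->
  exists T : 'I_n -> 'I_n -> bop H,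
    (forall i j, corner e M (T i j)) /\ (forall i j, gram W i j = gram T i j).
Proof.
move=> cW.
have corner0 : corner e M 0.
  by apply: in_corner; [exact: vn0 | rewrite amul0r amul0l].
suff steps p : (p <= n)%N ->
    exists (T : nat -> 'I_n -> bop H) (V : 'I_m -> 'I_n -> bop H),
    [/\ forall l j, corner e M (T l j), in_left_ideal V,
        forall k (j : 'I_n), (j < p)%N -> V k j = 0
      & forall i j, gram W i j = \sum_(l < p) star (T l i) ** T l j + gram V i j].
  have [T [V [cT _ V0 WT]]] := steps n (leqnn n).
  exists (fun l => T l); split=> [i j|i j]; first exact: cT.
  rewrite WT [X in _ + X]big1 ?addr0 // => k _.
  by rewrite V0 // star0 amul0l.
elim: p => [|p IH] pn.
  exists (fun _ _ => 0), W; split=> // i j; by rewrite big_ord0 add0r.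
have [T [V [cT cV V0 WT]]] := IH (ltnW pn).
have [row [V' [crow cV' V'p V'0 VV']]] := gram_schmidt_step (Ordinal pn) cV.
exists (fun l => if l == p then row else T l), V'; split=> //.
- by move=> l j; case: eqP.
- move=> k j; rewrite ltnS leq_eqVlt => /orP[/eqP jp|jp].
    by have -> : j = Ordinal pn by exact/val_inj.
  by apply: V'0 => i; apply: V0.
- move=> i j; rewrite WT big_ord_recr /= eqxx VV' addrA; congr (_ + _ + _).
  by apply: eq_bigr => l _; rewrite ltn_eqF.
Qed.

End GramSchmidt.

(** * Bounds from complete positivity *)

Section CompletePositivity.
Variables (R : realType) (H : hilbertType R).

Lemma discriminant_le (a b c : R) : 0 <= a ->
  (forall t, 0 <= t ^+ 2 * a + 2 * t * b + c) -> b ^+ 2 <= a * c.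
Proof.
rewrite le_eqVlt => /orP[/eqP<-|a0] q.
  rewrite mul0r; have [->|b0] := eqVneq b 0; first by rewrite expr0n.
  have := q (- (c + 1) / (2 * b)).
  have -> : (- (c + 1) / (2 * b)) ^+ 2 * 0 + 2 * (- (c + 1) / (2 * b)) * b + c = -1.
    by field.
  by rewrite ler0N1.
have := q (- b / a).
have -> : (- b / a) ^+ 2 * a + 2 * (- b / a) * b + c = (a * c - b ^+ 2) / a.
  by field; rewrite gt_eqF.
by rewrite pmulr_lge0 ?invr_gt0 // subr_ge0.
Qed.

Lemma gram_cauchy_schwarz m n (W : 'I_m -> 'I_n -> bop H) i j x y :
  rinner (gram W i j x) y ^+ 2 <=
    rinner (gram W i i y) y * rinner (gram W j j x) x.
Proof.
have gramE i' j' z w : rinner (gram W i' j' z) w =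
    \sum_k rinner (W k j' z) (W k i' w).
  rewrite /gram bop_sum; elim/big_rec2: _ => [|k u v _ <-].
    by rewrite linear0l.
  by rewrite rinnerDl bopM -rinner_adjr.
apply: discriminant_le => [|t].
  by rewrite gramE sumr_ge0 // => k _; rewrite rinner_norm sqr_ge0.
rewrite !gramE !mulr_sumr -!big_split sumr_ge0 // => k _ /=.
apply: le_trans (sqr_ge0 (rnorm (t%:C%C *: W k i y + W k j x))) _.
rewrite rnormD2 rnormZ rinnerZl !rinner_norm [rinner (W k i y) _]rinnerC.
by rewrite [2 * (t * _)]mulrA lexx.
Qed.

(** If F 0 = c + d with d > 0, then F n >= c + (n + 1) d for all n, against
    boundedness. *)
Lemma squaring_bound (F : nat -> R) (c B : R) : 0 <= c ->
  (forall n, F n ^+ 2 <= c * F n.+1) -> (forall n, F n <= B) -> F 0%N <= c.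
Proof.
move=> c0 Fs FB; rewrite leNgt; apply/negP => cF.
have [c1|] := ltP 0 c; last first.
  move=> c1; have c00 : c = 0 by apply/eqP; rewrite eq_le c1.
  have := Fs 0%N; rewrite c00 mul0r => F0; have : 0 < F 0%N by lra.
  by move=> /(exprn_gt0 2); lra.
pose d := F 0%N - c; have d0 : 0 < d by rewrite subr_gt0.
have grow n : c + n.+1%:R * d <= F n.
  elim: n => [|n IH]; first by rewrite mul1r addrC subrK.
  rewrite -(ler_pM2l c1); apply: le_trans (Fs n).
  have nd : 0 <= n%:R * d by rewrite mulr_ge0 ?(ltW d0).
  move: IH; rewrite -![_.+1%:R]natr1 !mulrDl !mul1r; set u := n%:R * d in nd *.
  nra.
have [n nB] : exists n : nat, B < n%:R * d.
  exists (Num.truncn (B / d)).+1; rewrite -ltr_pdivrMr //.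
  exact: truncnS_gt.
have := grow n; have := FB n; rewrite -natr1 mulrDl mul1r; lra.
Qed.

Variables (M : set (bop H)) (A : cstarAlgType R) (phi : {linear A -> bop H}).
Hypothesis hphi : completely_positive M phi.
Hypothesis phi_bounded : bounded_map phi.

(** The matrix (b_i^* b_j) is positive, being Y^* Y where Y has first row b and
    zeros elsewhere. *)
Lemma cp_gram n (b : 'I_n.+1 -> A) :
  exists Z : 'I_n.+1 -> 'I_n.+1 -> bop H,
    (forall k j, M (Z k j)) /\ forall i j, phi (star (b i) ** b j) = gram Z i j.
Proof.
have [_ /(_ n.+1 (\matrix_(i, j) (star (b i) ** b j)))[]] := hphi.
  exists (\matrix_(k, j) (if k == ord0 then b j else 0)) => // i j.
  rewrite mxE (bigD1 ord0) //= !mxE eqxx big1 ?addr0 // => k /negPf k0.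
  by rewrite !mxE k0 amul0r.
move=> Z MZ ZE; exists (fun k j => Z k j); split=> // i j.
by have := ZE i j; rewrite !mxE.
Qed.

Lemma cp_one : positive_op (phi aone) /\ M (phi aone).
Proof.
split; last by case: hphi => + _; apply.
have [Z [_ Zb]] := cp_gram (fun _ : 'I_1 => aone).
have := Zb ord0 ord0; rewrite star1 amul1l => ->; exact: gram_positive.
Qed.

(** Complete positivity is used at the 2 x 2 matrix with entries 1, a, a^* and
    a^* a. *)
Lemma cp_cauchy_schwarz a x y :
  rinner (phi a x) y ^+ 2 <=
    rinner (phi aone y) y * rinner (phi (star a ** a) x) x.
Proof.
have [Z [_ Zb]] := cp_gram (fun i : 'I_2 => if i == ord0 then aone else a).
have := Zb ord0 ord_max; have := Zb ord0 ord0; have := Zb ord_max ord_max.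
by rewrite /= !star1 !amul1l => -> -> ->; apply: gram_cauchy_schwarz.
Qed.

(** phi (a^* a) <= r phi 1. For b = a^* a / r of norm at most 1, the
    Cauchy-Schwarz inequality gives f_n^2 <= (phi 1 x, x) f_(n+1) for
    f_n = (phi (b^(2^n)) x, x), and a bounded sequence satisfying this cannot
    start above (phi 1 x, x). *)
Lemma cp_square_le a : exists2 r : R, 1 <= r & forall x,
  rinner (phi (star a ** a) x) x <= r * rinner (phi aone x) x.
Proof.
have normAE (b : A) : `|b| = (complex.Re `|b|)%:C%C by rewrite RRe_real // normr_real.
pose r : R := complex.Re `|a| ^+ 2 + 1.
have r1 : 1 <= r by rewrite lerDr sqr_ge0.
have r0 : 0 < r by apply: lt_le_trans r1.
exists r => // x.
pose b : A := (r^-1)%:C%C *: (star a ** a).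
have sb : star b = b by rewrite starZ_real starM starK.
have b1 : `|b| <= 1.
  rewrite normrZ norm_star_amul normAE -rmorphXn ger0_norm ?ler0c ?invr_ge0 ?(ltW r0) //.
  by rewrite -rmorphM -(rmorph1 (real_complex R)) lecR ler_pdivrMl // mulr1 /r lerDl.
pose bs n : A := iter n (fun c => c ** c) b.
have sbs n : star (bs n) = bs n.
  by elim: n => [|n IH] //=; rewrite starM -/(bs n) IH.
have bs1 n : `|bs n| <= 1.
  elim: n => [|n IH] //=; apply: le_trans (norm_amul_le _ _) _.
  by rewrite mulr_ile1.
have [K phiK] := phi_bounded.
have bound n : rinner (phi (bs n) x) x <= complex.Re `|K| * rnorm x ^+ 2.
  apply: le_trans (rinner_le _ _) _; rewrite expr2 mulrA.
  rewrite ler_wpM2r ?rnorm_ge0 //.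
  rewrite -lecR rmorphM /= -!normCE [(complex.Re `|K|)%:C%C]RRe_real ?normr_real //.
  have le1 := phiK (bs n) x; apply: (le_trans le1).
  rewrite -[leLHS]ger0_norm; last exact: le_trans le1.
  rewrite !normrM !normr_id ler_wpM2r //.
  by rewrite -[leRHS]mulr1 ler_wpM2l.
have h0 : 0 <= rinner (phi aone x) x by have [[_ +] _] := cp_one; apply.
have := @squaring_bound (fun n => rinner (phi (bs n) x) x) _ _ h0 _ bound.
have -> : phi (bs 0%N) = (r^-1)%:C%C *: phi (star a ** a) by apply: linearZ.
rewrite bopZ rinnerZl ler_pdivrMl //; apply=> n.
by have := cp_cauchy_schwarz (bs n) x x; rewrite sbs.
Qed.

Lemma cp_form_bound s a : star s = s -> s ** s = phi aone ->
  exists2 K : R, 0 <= K & forall x y,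
    rinner (phi a x) y <= K * (rnorm (s x) * rnorm (s y)).
Proof.
move=> ss sh; have [r r1 ra] := cp_square_le a.
have hE x : rinner (phi aone x) x = rnorm (s x) ^+ 2.
  by rewrite -sh bopM (rinner_sa _ _ ss) rinner_norm.
exists r => [|x y]; first by lra.
have := cp_cauchy_schwarz a x y; have := ra x; rewrite !hE.
have := rnorm_ge0 (s x); have := rnorm_ge0 (s y).
move: (rnorm (s x)) (rnorm (s y)) (rinner (phi a x) y)
  (rinner (phi (star a ** a) x) x) => p q u w p0 q0 h1 h2.
have h3 : u ^+ 2 <= (r * (p * q)) ^+ 2.
  apply: le_trans h2 _.
  apply: (@le_trans _ _ (q ^+ 2 * (r * p ^+ 2))); first by rewrite ler_wpM2l ?sqr_ge0.
  have -> : q ^+ 2 * (r * p ^+ 2) = r * (p * q) ^+ 2 by ring.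
  rewrite [leRHS]exprMn ler_wpM2r ?sqr_ge0 // expr2 ler_peMl //; lra.
have b0 : 0 <= r * (p * q) by rewrite !mulr_ge0 //; lra.
have [u0|u0] := leP 0 u; last by lra.
by rewrite -(@ler_pXn2r _ 2) ?nnegrE.
Qed.

End CompletePositivity.

(** * The extension *)

Theorem proposition2p4 (R : realType) (H : hilbertType R) (M : set (bop H))
    (A : cstarAlgType R) (C : set A) (pi : A -> bop H)
    (phi : {linear A -> bop H})
    (hM : von_neumann_algebra M)
    (hC : cstar_subalgebra C) (hC1 : C aone)
    (hpi : unital_star_hom C M pi)
    (hphi : completely_positive M phi)
    (hphiC : bimodule_map C pi phi) :
  exists e : bop H,
    [/\ projection e,
        (M `&` commutant (pi @` C)) e,
        forall a, corner e M (phi a)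
      & exists psi : {linear A -> bop H},
          completely_positive (corner e M) psi /\
          forall c, C c -> psi c = e ** pi c ** e].
Proof.
have [phi_bounded phiC] := hphiC.
have [pos_h Mh] := cp_one hphi.
have [s [e [se sh sc]]] := positive_root pos_h.
have [ss [ee es] se1 _ _] := se.
have ese : e ** s = s := support_projM se.
have Ms : M s := vn_root hM Mh sc.
have Me : M e := vn_support hM se Ms.
have [piM _ _ pi_star pi1] := hpi.
have phi_pi c : C c -> phi c = pi c ** phi aone.
  by move=> Cc; have := phiC aone c aone Cc hC1; rewrite !amul1r pi1 amul1r.
have pi_s c : C c -> pi c ** s = s ** pi c.
  move=> Cc; apply: sc; rewrite -phi_pi //.
  by have := phiC aone aone c hC1 Cc; rewrite !amul1l pi1 amul1l.
have pi_e c : C c -> pi c ** e = e ** pi c.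
  move=> Cc; apply: (support_comm se); first exact: pi_s.
  rewrite -pi_star //; apply: pi_s.
  by have [[_ _ _ +] _] := hC; apply.
have form a := cp_form_bound hphi phi_bounded a ss sh.
have /choice[T TP] a : exists t, s ** t ** s = phi a /\ e ** t ** e = t.
  by have [K K0 aK] := form a; apply: (sandwich_factor se K0 aK).
have sTs a : s ** T a ** s = phi a by case: (TP a).
have eTe a : e ** T a ** e = T a by case: (TP a).
have Mphi a : M (phi a) by case: hphi => + _; apply.
have MT a : M (T a) by apply: (vn_sandwich hM se Ms (eTe a)); rewrite sTs.
have Tlin : linear T.
  move=> k a b; apply: (sandwich_inj se) => //.
    by rewrite amulDr amulDl amulZr amulZl !eTe.
  by rewrite amulDr amulDl amulZr amulZl !sTs linearP.
pose psi : {linear A -> bop H} := HB.pack T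
  (GRing.isLinear.Build R[i] A (bop H) *:%R T Tlin).
exists e; split=> //.
- by split=> // _ [c Cc <-]; apply: pi_e.
- move=> a; apply: in_corner => //.
  by rewrite -sTs !amulA ese -amulA se1.
exists psi; split; last first.
  move=> c Cc; apply: (sandwich_inj se); first exact: eTe.
    by rewrite !amulA ee -amulA ee.
  have -> : s ** (e ** pi c ** e) ** s = s ** pi c ** s.
    by rewrite !amulA se1 -amulA ese.
  by rewrite [LHS]sTs phi_pi // -sh amulA pi_s.
split=> [a|n X]; first exact: in_corner.
move=> /(proj2 hphi)[Z MZ ZE].
have ZX i j : phi (X i j) = gram (fun k l => Z k l) i j.
  by have := ZE i j; rewrite mxE.
(* |Z_kj x|^2 <= (phi(X_jj) x, x) <= K |s x|^2, and K <= (K + 1)^2 *)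
have fac k j : exists w, w ** s = Z k j /\ w ** e = w.
  have [K K0 jK] := form (X j j).
  apply: (@douglas _ _ s e (Z k j) (K + 1)) => // x.
  have := jK x x; have := gram_norm (fun k l => Z k l) j k x; rewrite -ZX.
  move=> h1 h2; have Kx : 0 <= (K + 1) * rnorm (s x).
    by rewrite mulr_ge0 ?rnorm_ge0 ?addr_ge0.
  rewrite -(@ler_pXn2r _ 2) ?nnegrE ?rnorm_ge0 //.
  apply: (le_trans h1); apply: (le_trans h2).
  rewrite exprMn -expr2 ler_wpM2r ?sqr_ge0 //; nra.
have /choice[W WP] k : exists w : 'I_n -> bop H,
    forall j, w j ** s = Z k j /\ w j ** e = w j.
  by have [w wP] := choice (fac k); exists w.
have Ws k j : W k j ** s = Z k j by case: (WP k j).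
have We k j : W k j ** e = W k j by case: (WP k j).
have cW : in_left_ideal M e W.
  by move=> k j; split=> //; apply: (vn_douglas hM se Ms (We k j)); rewrite Ws.
have psiW i j : psi (X i j) = gram W i j.
  apply: (sandwich_inj se); first exact: eTe.
    rewrite /gram amul_sumr amul_suml; apply: eq_bigr => k _.
    by rewrite amulA -{1}es -starM We -amulA We.
  rewrite [LHS]sTs ZX /gram amul_sumr amul_suml; apply: eq_bigr => k _.
  by rewrite amulA -{1}ss -starM Ws -amulA Ws.
have [V [cV VW]] := gram_schmidt hM (conj ee es) cW.
exists (\matrix_(i, j) V i j) => [i j|i j]; first by rewrite mxE.
rewrite mxE psiW VW; apply: eq_bigr => k _.
by rewrite !mxE.
Qed.
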